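(* Let $N\ge1$, $f\in\mathbb{C}^{2N-1}$, $\tau>0$ and $1<q<\infty$. Let $\mu_1,\ldots,\mu_{2N-1}$ be positive weights and assume that $q\ge\max_l(\mu_l/\beta_l)$. Set $$F=\Lambda\left(\frac{f\mu}{q\beta}\right),\qquad \mathsf{U}(F,A)=F+A-\Lambda\left(\frac{\mu}{q\beta^2}\Lambda^*(A)\right).$$ Let $(W',A')=\mathfrak{B}_{\mathrm{weight}}(W,A)$, for $W\in\mathbb{M}_{N,N}$ and $A\in\mathcal{H}$, be defined by $$W'=\mathfrak{S}_{s_{\tau,q}}\Big(q\,\mathsf{U}(F,A)+\mathcal{P}_{\mathcal{H}^\perp}(W)\Big),\qquad A'=\frac{1}{q-1}\Big(q\,\mathsf{U}(F,A)-\mathcal{P}_{\mathcal{H}}(W')\Big).$$ Let $A^{\circ}=\Lambda(a^{\circ})$ with $a^{\circ}\in\mathbb{C}^{2N-1}$. Then there exists $W^{\circ}$ such that $(W^{\circ},A^{\circ})$ is a fixed point of $\mathfrak{B}_{\mathrm{weight}}$ if and only if $A^{\circ}=\Lambda(a^{\circ})$ is a stationary point of the objective functional $$\mathcal{R}_{\tau}(\Lambda a)+\sum_{l}\mu_l\,|a_l-f_l|^2 .$$ The objective functional is convex if $\min_l(\mu_l/\beta_l)\ge1$, and strictly convex if $\min_l(\mu_l/\beta_l)>1$.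
   Context: $\mathbb{M}_{N,N}$ is the Euclidean space of complex $N\times N$ matrices with the Frobenius norm; $\sigma_j(A)$ denotes singular values. For $\tau>0$, $\mathcal{R}_{\tau}(A)=\sum_j\left(\tau^2-(\max(\tau-\sigma_j(A),0))^2\right)$. $\mathcal{H}\subset\mathbb{M}_{N,N}$ is the subspace of Hankel matrices (constant along anti-diagonals). $\Lambda:\mathbb{C}^{2N-1}\to\mathbb{M}_{N,N}$ is the map forming the Hankel matrix of a sequence, $(\Lambda a)_{j,k}=a_{j+k-1}$, $1\le j,k\le N$. Its adjoint is $(\Lambda^*A)_l=\sum_{1\le j,k\le N,\ j+k-1=l}A_{j,k}$, and $\beta_l=\#\{(j,k):1\le j,k\le N,\ j+k-1=l\}$, $1\le l\le 2N-1$. Products and quotients of sequences such as $f\mu/(q\beta)$ and $\frac{\mu}{q\beta^2}\Lambda^*(A)$ are taken pointwise. $\mathcal{P}_{\mathcal{H}}$, $\mathcal{P}_{\mathcal{H}^\perp}$ are the orthogonal projections onto $\mathcal{H}$ and its orthogonal complement. For a real-valued $g$ on $[0,\infty)$ with $g(0)=0$ and a singular value decomposition $A=U\,\mathrm{diag}(\{\sigma_j(A)\})V^*$, $\mathfrak{S}_g(A)=U\,\mathrm{diag}(\{g(\sigma_j(A))\})V^*$. Here $s_{\tau,q}(\sigma)=\max\left(\min(\sigma,\tau),\frac{\sigma}{q}\right)$. The objective is viewed as a functional on $\mathcal{H}$ through the bijection $a\mapsto\Lambda a$. Since $\mathcal{R}_\tau(A)+\|A\|^2$ is convex, it is a convex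 function plus a smooth quadratic; a stationary point is a point at which $0$ belongs to its subdifferential (convex subdifferential of the convex part plus gradient of the smooth part, over the reals). *)

(* Defs.v *)
From HB Require Import structures.
From mathcomp Require Import all_boot all_order all_algebra.
From mathcomp Require Import complex.
From mathcomp Require Import boolp classical_sets reals.
From mathcomp Require Import ring lra zify.

Set Implicit Arguments.
Unset Strict Implicit.
Unset Printing Implicit Defensive.

Import Order.TTheory GRing.Theory Num.Theory ComplexField.

Local Open Scope ring_scope.
Local Open Scope complex_scope.
Local Open Scope sesquilinear_scope.
Local Open Scope classical_set_scope.

Definition fdot (R : realType) (N : nat) (A B : 'M[R[i]]_N) : R[i] :=
  \tr (A *m B ^t*).

(* The underlying real inner product, used for subgradients and gradients. *)
Definition rdot (R : realType) (N : nat) (A B : 'M[R[i]]_N) : R :=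
  complex.Re (fdot A B).

Definition fnorm (R : realType) (N : nat) (A : 'M[R[i]]_N) : R :=
  Num.sqrt (rdot A A).

Definition orth_compl (R : realType) (N : nat) (S : set 'M[R[i]]_N) :
    set 'M[R[i]]_N :=
  [set A | forall B, S B -> fdot A B = 0].

(* The B in S with A - B orthogonal to S; it exists and is unique when S is a
   linear subspace (see orth_proj_hankel and orth_proj_hankel_compl). *)
Definition orth_proj (R : realType) (N : nat) (S : set 'M[R[i]]_N)
    (A : 'M[R[i]]_N) : 'M[R[i]]_N :=
  xget 0 [set B | S B /\ orth_compl S (A - B)].

(* The singular values need not be sorted: everything below is invariant
   under permuting them. *)
Definition is_svd (R : realType) (N : nat) (A : 'M[R[i]]_N)
    (d : 'M[R[i]]_N * 'rV[R]_N * 'M[R[i]]_N) : Prop :=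
  let: (U, s, V) := d in
  [/\ U \is unitarymx, V \is unitarymx, (forall j, 0 <= s 0 j) &
      A = U *m diag_mx (map_mx (real_complex R) s) *m V ^t*].

(* A chosen singular value decomposition; existence is svd_exists, and
   independence of the choice is Rtau_svd and Sfun_svd. *)
Definition svd (R : realType) (N : nat) (A : 'M[R[i]]_N) :
    'M[R[i]]_N * 'rV[R]_N * 'M[R[i]]_N :=
  xget (0, 0, 0) [set d | is_svd A d].

Definition sigma (R : realType) (N : nat) (A : 'M[R[i]]_N) (j : 'I_N) : R :=
  (svd A).1.2 0 j.

Definition Sfun (R : realType) (N : nat) (g : R -> R) (A : 'M[R[i]]_N) :
    'M[R[i]]_N :=
  (svd A).1.1 *m diag_mx (\row_j (g (sigma A j))%:C) *m (svd A).2 ^t*.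

Definition Rtau (R : realType) (N : nat) (tau : R) (A : 'M[R[i]]_N) : R :=
  \sum_(j < N) (tau ^+ 2 - Num.max (tau - sigma A j) 0 ^+ 2).

Definition s_fun (R : realType) (tau q : R) (x : R) : R :=
  Num.max (Num.min x tau) (x / q).

(* Indices start at 0, so the 1-based j + k - 1 becomes j + k. *)

Lemma antidiag_subproof (N : nat) (j k : 'I_N) : (j + k < 2 * N - 1)%N.
Proof. have := ltn_ord j; have := ltn_ord k; lia. Qed.

Definition antidiag (N : nat) (j k : 'I_N) : 'I_(2 * N - 1) :=
  Ordinal (antidiag_subproof j k).

Definition Lam (R : realType) (N : nat) (a : 'rV[R[i]]_(2 * N - 1)) :
    'M[R[i]]_N :=
  \matrix_(j, k) a 0 (antidiag j k).

Definition Lam_adj (R : realType) (N : nat) (A : 'M[R[i]]_N) :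
    'rV[R[i]]_(2 * N - 1) :=
  \row_l \sum_(p : 'I_N * 'I_N | antidiag p.1 p.2 == l) A p.1 p.2.

Definition beta (R : realType) (N : nat) (l : 'I_(2 * N - 1)) : R :=
  #|[pred p : 'I_N * 'I_N | antidiag p.1 p.2 == l]|%:R.
Arguments beta R {N} l.

Definition hankel (R : realType) (N : nat) : set 'M[R[i]]_N :=
  [set A | forall j k j' k' : 'I_N, (j + k = j' + k')%N -> A j k = A j' k'].
Arguments hankel R N : clear implicits.

(* Averaging along anti-diagonals; its restriction to hankel is the inverse of
   Lam (LamK, Lam_invK). *)
Definition Lam_inv (R : realType) (N : nat) (A : 'M[R[i]]_N) :
    'rV[R[i]]_(2 * N - 1) :=
  \row_l ((beta R l)^-1%:C * Lam_adj A 0 l).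

Definition Umap (R : realType) (N : nat) (q : R) (mu : 'rV[R]_(2 * N - 1))
    (F A : 'M[R[i]]_N) : 'M[R[i]]_N :=
  F + A - Lam (\row_l ((mu 0 l / (q * beta R l ^+ 2))%:C * Lam_adj A 0 l)).

Definition Fmat (R : realType) (N : nat) (q : R) (mu : 'rV[R]_(2 * N - 1))
    (f : 'rV[R[i]]_(2 * N - 1)) : 'M[R[i]]_N :=
  Lam (\row_l (f 0 l * (mu 0 l)%:C / (q * beta R l)%:C)).

Definition Bweight (R : realType) (N : nat) (tau q : R)
    (mu : 'rV[R]_(2 * N - 1)) (f : 'rV[R[i]]_(2 * N - 1))
    (WA : 'M[R[i]]_N * 'M[R[i]]_N) : 'M[R[i]]_N * 'M[R[i]]_N :=
  let: (W, A) := WA in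
  let qU := q%:C *: Umap q mu (Fmat q mu f) A in
  let W' := Sfun (s_fun tau q)
              (qU + orth_proj (orth_compl (hankel R N)) W) in
  let A' := (q - 1)^-1%:C *: (qU - orth_proj (hankel R N) W') in
  (W', A').

Definition objective (R : realType) (N : nat) (tau : R)
    (mu : 'rV[R]_(2 * N - 1)) (f a : 'rV[R[i]]_(2 * N - 1)) : R :=
  Rtau tau (Lam a) + \sum_l mu 0 l * Normc.normc (a 0 l - f 0 l) ^+ 2.

(* The objective as a functional on hankel (values elsewhere are junk). *)
Definition objectiveH (R : realType) (N : nat) (tau : R)
    (mu : 'rV[R]_(2 * N - 1)) (f : 'rV[R[i]]_(2 * N - 1))
    (A : 'M[R[i]]_N) : R :=
  objective tau mu f (Lam_inv A).

(* S is a linear subspace below; t is real. *)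

Definition convex_on (R : realType) (N : nat) (S : set 'M[R[i]]_N)
    (phi : 'M[R[i]]_N -> R) : Prop :=
  forall A B (t : R), S A -> S B -> 0 <= t <= 1 ->
    phi (t%:C *: A + (1 - t)%:C *: B) <= t * phi A + (1 - t) * phi B.

Definition strictly_convex_on (R : realType) (N : nat) (S : set 'M[R[i]]_N)
    (phi : 'M[R[i]]_N -> R) : Prop :=
  forall A B (t : R), S A -> S B -> A <> B -> 0 < t < 1 ->
    phi (t%:C *: A + (1 - t)%:C *: B) < t * phi A + (1 - t) * phi B.

Definition subdifferential (R : realType) (N : nat) (S : set 'M[R[i]]_N)
    (phi : 'M[R[i]]_N -> R) (A : 'M[R[i]]_N) : set 'M[R[i]]_N :=
  [set G | S G /\ forall B, S B -> phi A + rdot G (B - A) <= phi B].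

Definition is_gradient (R : realType) (N : nat) (S : set 'M[R[i]]_N)
    (psi : 'M[R[i]]_N -> R) (A G : 'M[R[i]]_N) : Prop :=
  S G /\ forall eps : R, 0 < eps -> exists2 delta : R, 0 < delta &
    forall B, S B -> fnorm (B - A) < delta ->
      `|psi B - psi A - rdot G (B - A)| <= eps * fnorm (B - A).

(* J = c + (J - c) with c convex and J - c smooth, and
   0 = G + H with G in the subdifferential of c and H the gradient of J - c. *)
Definition stationary (R : realType) (N : nat) (S : set 'M[R[i]]_N)
    (c J : 'M[R[i]]_N -> R) (A : 'M[R[i]]_N) : Prop :=
  exists G H, [/\ subdifferential S c A G,
    is_gradient S (fun B => J B - c B) A H & G + H = 0].

Definition convex_part (R : realType) (N : nat) (tau : R) (A : 'M[R[i]]_N) : R :=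
  Rtau tau A + fnorm A ^+ 2.

Section Hankel.
Variables (R : realType) (N : nat).
Implicit Types (A B : 'M[R[i]]_N) (a : 'rV[R[i]]_(2 * N - 1)).

Lemma beta_gt0 l : 0 < beta R (N := N) l.
Proof.
rewrite /beta ltr0n lt0n; apply/pred0Pn.
have hl := ltn_ord l.
have h1 : (minn l (N - 1) < N)%N by lia.
have h2 : (l - minn l (N - 1) < N)%N by lia.
exists (Ordinal h1, Ordinal h2); rewrite inE -val_eqE /=; lia.
Qed.

Lemma Lam_hankel a : hankel R N (Lam a).
Proof. by move=> j k j' k' e; rewrite !mxE; congr (a 0 _); apply: val_inj. Qed.

Lemma LamK : cancel (@Lam R N) (@Lam_inv R N).
Proof.
move=> a; apply/rowP => l; rewrite !mxE.
rewrite (eq_bigr (fun=> a 0 l)); last first.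
  by move=> p /eqP <-; rewrite !mxE.
rewrite sumr_const -mulr_natr mulrCA.
have -> : #|[pred p : 'I_N * 'I_N | antidiag p.1 p.2 == l]|%:R
   = (beta R l)%:C :> R[i].
  rewrite /beta rmorph_nat; congr (_%:R); apply: eq_card => p; by rewrite !inE.
by rewrite -rmorphM /= mulVf ?mulr1 // gt_eqF // beta_gt0.
Qed.

Lemma Lam_invK A : hankel R N A -> Lam (Lam_inv A) = A.
Proof.
move=> hA; pose a : 'rV[R[i]]_(2 * N - 1) :=
  \row_l (if [pick p : 'I_N * 'I_N | antidiag p.1 p.2 == l] is Some p
          then A p.1 p.2 else 0).
suff -> : A = Lam a by rewrite LamK.
apply/matrixP => j k; rewrite !mxE; case: pickP => [p|/(_ (j, k))] /=.
  by move=> /eqP/(congr1 val) /= e; apply: hA.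
by rewrite eqxx.
Qed.

Lemma fdotE A B : fdot A B = \sum_j \sum_k A j k * (B j k)^*.
Proof.
rewrite /fdot /mxtrace; apply: eq_bigr => j _; rewrite mxE.
by apply: eq_bigr => k _; rewrite !mxE.
Qed.

Lemma fdot_Lam_adj A a : fdot A (Lam a) = \sum_l Lam_adj A 0 l * (a 0 l)^*.
Proof.
rewrite fdotE pair_big /= (partition_big (fun p => antidiag p.1 p.2) xpredT) //=.
apply: eq_bigr => l _; rewrite mxE mulr_suml; apply: eq_bigr => p /eqP <-.
by rewrite mxE.
Qed.

Lemma fdotC A B : fdot B A = (fdot A B)^*.
Proof.
rewrite !fdotE rmorph_sum; apply: eq_bigr => j _; rewrite rmorph_sum.
by apply: eq_bigr => k _; rewrite rmorphM /= conjcK mulrC.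
Qed.

Lemma fdotBl A B D : fdot (A - B) D = fdot A D - fdot B D.
Proof. by rewrite /fdot mulmxBl raddfB. Qed.

Lemma fdot_eq0 A : fdot A A = 0 -> A = 0.
Proof.
rewrite fdotE pair_big /= => h; apply/matrixP => j k; rewrite mxE.
have hp (p : 'I_N * 'I_N) : true -> 0 <= A p.1 p.2 * (A p.1 p.2)^*.
  by rewrite -sqr_normc exprn_ge0.
have /eqP := h; rewrite psumr_eq0 // => /allP /(_ (j, k)).
rewrite mem_index_enum => /(_ isT) /=.
by rewrite -sqr_normc expf_eq0 normr_eq0 => /eqP.
Qed.

Lemma Lam_inv_orth A : orth_compl (hankel R N) (A - Lam (Lam_inv A)).
Proof.
move=> B /Lam_invK <-; rewrite fdotBl !fdot_Lam_adj -sumrB.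
apply: big1 => l _; rewrite -mulrBl.
suff -> : Lam_adj (Lam (Lam_inv A)) 0 l = Lam_adj A 0 l by rewrite subrr mul0r.
have := congr1 (fun a : 'rV_ _ => a 0 l) (LamK (Lam_inv A)); rewrite !(mxE _ _ 0 l).
apply: mulfI; rewrite -(rmorph0 (real_complex R)) (inj_eq (@complexI _)).
by rewrite invr_eq0 gt_eqF // beta_gt0.
Qed.

Lemma orth_proj_unique (S : set 'M[R[i]]_N) A B :
  (forall X Y, S X -> S Y -> S (X - Y)) ->
  S B -> orth_compl S (A - B) -> orth_proj S A = B.
Proof.
move=> hS sB oB; apply: xget_unique; first by split.
move=> B' [sB' oB'].
apply/esym/eqP; rewrite -subr_eq0; apply/eqP/fdot_eq0.
have sD := hS _ _ sB sB'.
have {1}-> : B - B' = (A - B') - (A - B) by apply/matrixP => i j; rewrite !mxE; ring.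
by rewrite fdotBl oB ?oB' ?subr0.
Qed.

Lemma orth_proj_hankel A : orth_proj (hankel R N) A = Lam (Lam_inv A).
Proof.
apply: orth_proj_unique; [|exact: Lam_hankel|exact: Lam_inv_orth].
by move=> X Y hX hY j k j' k' e; rewrite !mxE (hX _ _ _ _ e) (hY _ _ _ _ e).
Qed.

Lemma orth_proj_hankel_compl A :
  orth_proj (orth_compl (hankel R N)) A = A - Lam (Lam_inv A).
Proof.
apply: orth_proj_unique; last 1 first.
- rewrite opprB addrC subrK => B oB.
  by rewrite fdotC oB ?rmorph0 //; exact: Lam_hankel.
- by move=> X Y hX hY B hB; rewrite fdotBl hX // hY // subrr.
- exact: Lam_inv_orth.
Qed.

End Hankel.

Section Orthonormal.
Variables (C : numClosedFieldType) (N : nat).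
Implicit Types (W Y V : 'M[C]_N).

Lemma gram_eq0 Y i : (Y *m Y ^t*) i i = 0 -> forall j, Y i j = 0.
Proof.
rewrite mxE => h j.
have hp (k : 'I_N) : true -> 0 <= Y i k * (Y ^t*) k i.
  by rewrite !mxE mul_conjC_ge0.
have /eqP := h; rewrite psumr_eq0 // => /allP /(_ j).
by rewrite mem_index_enum !mxE mul_conjC_eq0 => /(_ isT) /eqP.
Qed.

Lemma orthonormal_completion k (b : pred 'I_N) W :
  (#|[pred i | ~~ b i]| <= k)%N ->
  (forall i j, (W *m W ^t*) i j = ((i == j) && b i)%:R) ->
  exists2 V, V \is unitarymx & forall i, b i -> row i V = row i W.
Proof.
elim: k b W => [|k IH] b W hk hW.
  exists W => //; apply/unitarymxP/matrixP => i j; rewrite hW mxE.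
  move: hk; rewrite leqn0 => /eqP /card0_eq /(_ i); rewrite !inE => /negbFE ->.
  by rewrite andbT.
have [hb|[i0 hi0]] : (forall i, b i) \/ exists i, ~~ b i.
    by case: (pickP (fun i => ~~ b i)) => [i hi|h]; [right; exists i|left => i; apply: negbFE (h i)].
  by apply: (IH b) => //; rewrite eq_card0 // => i; rewrite !inE hb.
have W0 j : W i0 j = 0 by apply: gram_eq0; rewrite hW (negbTE hi0) andbF.
have kN0 : kermx (W ^t*) != 0.
  rewrite kermx_eq0 row_free_unit map_unitmx unitmx_tr; apply/negP => uW.
  have : delta_mx (0 : 'I_1) i0 *m W = 0.
    by rewrite -rowE; apply/rowP => j; rewrite !mxE W0.
  move/(congr1 (mulmx^~ (invmx W))); rewrite mulmxK // mul0mx.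
  move/rowP/(_ i0); rewrite !mxE !eqxx /= => /eqP; exact/negP/oner_neq0.
have /rowV0Pn[u /sub_kermxP uW uN0] := kN0.
have uu : 0 < (u *m u ^t*) 0 0 by rewrite -dotmxE; exact: dotmx_is_dotmx.
pose c := (sqrtC ((u *m u ^t*) 0 0))^-1.
have cR : (c^*)%R = c by apply: conj_Creal; rewrite ger0_real // invr_ge0 sqrtC_ge0 ltW.
pose v := c *: u.
have vW : v *m W ^t* = 0 by rewrite -scalemxAl uW scaler0.
have vv : v *m v ^t* = 1%:M.
  rewrite [LHS]mx11_scalar; congr (_%:M).
  rewrite linearZ /= map_mxZ -scalemxAl -scalemxAr scalerA mxE [X in c * X]cR -expr2 exprVn sqrtCK.
  by rewrite mulVf // gt_eqF.
have Wv : W *m v ^t* = 0.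
  by rewrite -[W]trmxCK -map_mxM -trmx_mul vW trmx0 map_mx0.
pose d : 'cV[C]_N := delta_mx i0 0.
pose W' := W + d *m v.
have [|i j|V hV hVW] := IH (fun i => b i || (i == i0)) W'.
- rewrite -ltnS (leq_trans _ hk) // [X in (_ < X)%N](cardD1 i0) inE hi0 add1n ltnS.
  apply/subset_leq_card/fintype.subsetP => i; rewrite !inE negb_or andbC //.
- have -> : W' *m W' ^t* = W *m W ^t* + d *m d ^t*.
    rewrite /W' linearD /= map_mxD mulmxDl !mulmxDr trmx_mul map_mxM.
    rewrite -[d *m v *m W ^t*]mulmxA vW mulmx0 add0r.
    rewrite [W *m (_ *m _)]mulmxA Wv mul0mx addr0.
    by rewrite [d *m v *m _]mulmxA -[d *m v *m _]mulmxA vv mulmx1.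
  rewrite mxE hW !mxE big_ord1 !mxE eqxx !andbT conjC_nat -natrM mulnb.
  case: (i =P i0) => [->|_]; last by rewrite orbF addr0.
  rewrite (negbTE hi0) andbF add0r orbT andbT eq_sym //.
exists V => // i bi; rewrite hVW ?bi //; apply/rowP => j.
rewrite !mxE big_ord1 !mxE; case: eqP => [e|_]; last by rewrite mul0r addr0.
by rewrite e (negbTE hi0) in bi.
Qed.

End Orthonormal.

Section SVD.
Variables (R : realType) (N : nat).
Implicit Types (A W Y U V : 'M[R[i]]_N) (s : 'rV[R]_N).

Lemma svd_exists A : exists d, is_svd A d.
Proof.
pose B := A *m A ^t*.
have nB : B \is normalmx.
  by apply/normalmxP; rewrite /B trmx_mul map_mxM trmxCK.
have BE := orthomx_spectralP nB.
set P := spectralmx B in BE; set D := spectral_diag B in BE.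
have uP : P \is unitarymx by exact: spectral_unitarymx.
pose Y := P *m A.
have YY : Y *m Y ^t* = diag_mx D.
  rewrite /Y trmx_mul map_mxM mulmxA -[P *m A *m _]mulmxA -/B BE.
  rewrite invmx_unitary // !mulmxA (unitarymxP uP) mul1mx.
  by rewrite -mulmxA (unitarymxP uP) mulmx1.
have YYi i : (Y *m Y ^t*) i i = D 0 i by rewrite YY mxE eqxx mulr1n.
have D_ge0 i : 0 <= D 0 i.
  by rewrite -YYi mxE sumr_ge0 // => k _; rewrite !mxE mul_conjC_ge0.
have [s s_ge0 sD] : exists2 s : 'rV[R]_N, (forall i, 0 <= s 0 i) &
    forall i, (s 0 i)%:C ^+ 2 = D 0 i.
  exists (\row_i Num.sqrt (complex.Re (D 0 i))) => i; rewrite mxE ?sqrtr_ge0 //.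
  rewrite -rmorphXn /= sqr_sqrtr ?RRe_real ?ger0_real //.
  by rewrite -lecR RRe_real ?ger0_real.
pose W : 'M[R[i]]_N := \matrix_(i, j) ((s 0 i)^-1%:C * Y i j).
have [|i j|V uV VW] := @orthonormal_completion _ N N (fun i => s 0 i != 0) W.
- by rewrite -[X in (_ <= X)%N]card_ord max_card.
- transitivity ((s 0 i)^-1%:C * (s 0 j)^-1%:C * (Y *m Y ^t*) i j).
    rewrite !mxE mulr_sumr; apply: eq_bigr => k _; rewrite !mxE rmorphM /=.
    by rewrite [X in _ * _ * (X * _)](conjc_real _) mulrACA.
  rewrite YY mxE; have [<-|ne] := eqVneq i j; last by rewrite mulr0n mulr0.
  rewrite mulr1n -sD /=; case: eqP => [->|/eqP s0] /=.
    by rewrite expr0n mulr0.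
  rewrite -rmorphXn -!rmorphM /= -expr2 -exprMn mulVf ?expr1n //.
exists (P ^t*, s, V ^t*); split.
- by rewrite trmxC_unitary.
- by rewrite trmxC_unitary.
- exact: s_ge0.
rewrite trmxCK -mulmxA.
have -> : diag_mx (map_mx (real_complex R) s) *m V = Y.
  apply/matrixP => i j; rewrite mul_diag_mx [LHS]mxE [map_mx _ _ _ _]mxE.
  have [s0|s0] := eqVneq (s 0 i) 0.
    by rewrite s0 mul0r (gram_eq0 (Y := Y)) // YYi -sD s0 expr0n.
  have /rowP /(_ j) := VW i s0; rewrite [LHS]mxE [RHS]mxE => ->.
  by rewrite [W _ _]mxE mulrA -rmorphM mulfV // mul1r.
by rewrite /Y mulmxA -invmx_unitary // mulVmx ?mul1mx // unitarymx_unit.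
Qed.

Lemma svdP A : is_svd A (svd A).
Proof. exact: (xgetPex (0, 0, 0) (svd_exists A)). Qed.

Lemma svd_intertwine A U1 s1 V1 U2 s2 V2 :
  is_svd A (U1, s1, V1) -> is_svd A (U2, s2, V2) ->
  forall i j, let p := (U2 ^t* *m U1) i j in let r := (V2 ^t* *m V1) i j in
    if s1 0 j == s2 0 i then s1 0 j = 0 \/ p = r else p = 0 /\ r = 0.
Proof.
move=> [uU1 uV1 p1 e1] [uU2 uV2 p2 e2] i j p r.
have U1U := unitarymxP (etrans (trmxC_unitary U1) uU1).
have V1U := unitarymxP (etrans (trmxC_unitary V1) uV1).
have U2U := unitarymxP (etrans (trmxC_unitary U2) uU2).
have V2U := unitarymxP (etrans (trmxC_unitary V2) uV2).
rewrite !trmxCK in U1U V1U U2U V2U.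
pose S s := diag_mx (map_mx (real_complex R) s) : 'M[R[i]]_N.
have Sadj s : (S s) ^t* = S s.
  rewrite /S tr_diag_mx map_diag_mx; congr diag_mx; apply/rowP => k.
  by rewrite !mxE; exact: conjc_real.
have H1 : (U2 ^t* *m U1) *m S s1 = S s2 *m (V2 ^t* *m V1).
  rewrite -[U2 ^t* *m U1 *m S s1]mulmx1 -[1%:M]V1U -!mulmxA; rewrite !mulmxA.
  have -> : U2 ^t* *m U1 *m S s1 *m V1 ^t* = S s2 *m V2 ^t*.
    by rewrite -!mulmxA [U1 *m _]mulmxA -e1 e2 !mulmxA U2U mul1mx.
  by rewrite -!mulmxA.
have H2 : (V2 ^t* *m V1) *m S s1 = S s2 *m (U2 ^t* *m U1).
  have e : V1 *m S s1 *m U1 ^t* = V2 *m S s2 *m U2 ^t*.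
    have := congr1 (fun X : 'M_N => X ^t*) (etrans (esym e1) e2).
    by rewrite !trmx_mul !map_mxM !trmxCK -/(S s1) -/(S s2) !Sadj !mulmxA.
  rewrite -[V2 ^t* *m V1 *m S s1]mulmx1 -[1%:M]U1U !mulmxA.
  have -> : V2 ^t* *m V1 *m S s1 *m U1 ^t* = S s2 *m U2 ^t*.
    by rewrite -!mulmxA [V1 *m _]mulmxA e !mulmxA V2U mul1mx.
  by rewrite -!mulmxA.
have h1 : p * (s1 0 j)%:C = (s2 0 i)%:C * r.
  have := congr1 (fun X : 'M_N => X i j) H1; rewrite mul_mx_diag mul_diag_mx.
  by rewrite [LHS]mxE [RHS]mxE !(mxE _ _ 0).
have h2 : r * (s1 0 j)%:C = (s2 0 i)%:C * p.
  have := congr1 (fun X : 'M_N => X i j) H2; rewrite mul_mx_diag mul_diag_mx.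
  by rewrite [LHS]mxE [RHS]mxE !(mxE _ _ 0).
have m : (p - r) * (s1 0 j + s2 0 i)%:C = 0.
  rewrite rmorphD /= mulrDr !mulrBl h1 h2; ring.
have q : (p + r) * (s1 0 j - s2 0 i)%:C = 0.
  rewrite rmorphB /= mulrBr !mulrDl h1 h2; ring.
have C0 (x : R) : (x%:C == 0 :> R[i]) = (x == 0).
  by rewrite -(rmorph0 (real_complex R)) (inj_eq (@complexI _)).
move/eqP: m; rewrite mulf_eq0 C0 subr_eq0.
move/eqP: q; rewrite mulf_eq0 C0 subr_eq0 => q m.
have [e|ne] := eqVneq (s1 0 j) (s2 0 i).
  move: m => /orP[/eqP pr|sum0]; [by right|left].
  have := p1 j; move: sum0; rewrite -e => /eqP; lra.
move: q; rewrite (negbTE ne) orbF addr_eq0 => /eqP pr.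
have : p == r.
  case/orP: m => // /eqP sum0; move/eqP: ne; case.
  have := p1 j; have := p2 i; lra.
rewrite pr eq_sym -addr_eq0 -mulr2n mulrn_eq0 /= => /eqP ->.
by rewrite oppr0.
Qed.

Lemma sum_svd_unique A U1 s1 V1 U2 s2 V2 (phi : R -> R) :
  is_svd A (U1, s1, V1) -> is_svd A (U2, s2, V2) ->
  \sum_j phi (s1 0 j) = \sum_j phi (s2 0 j).
Proof.
move=> h1 h2; have H := svd_intertwine h1 h2.
have [uU1 _ _ _] := h1; have [uU2 _ _ _] := h2.
pose P := U2 ^t* *m U1.
have uP : P \is unitarymx by rewrite mul_unitarymx // trmxC_unitary.
have uPt : P ^t* \is unitarymx by rewrite trmxC_unitary.
apply: (@complexI R); rewrite !rmorph_sum /=.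
transitivity (\sum_j \sum_i (phi (s1 0 j))%:C * (P i j * (P i j)^*)).
  apply: eq_bigr => j _; rewrite -mulr_sumr.
  suff -> : \sum_i P i j * (P i j)^* = 1 by rewrite mulr1.
  have := congr1 (fun X : 'M_N => X j j) (unitarymxP uPt).
  rewrite trmxCK [LHS]mxE [RHS]mxE eqxx => e; apply: etrans e.
  by apply: eq_bigr => i _; rewrite !(mxE _ _ j) mulrC.
rewrite exchange_big /=.
transitivity (\sum_i \sum_j (phi (s2 0 i))%:C * (P i j * (P i j)^*)); last first.
  apply: eq_bigr => i _; rewrite -mulr_sumr.
  suff -> : \sum_j P i j * (P i j)^* = 1 by rewrite mulr1.
  have := congr1 (fun X : 'M_N => X i i) (unitarymxP uP).
  rewrite [LHS]mxE [RHS]mxE eqxx => e; apply: etrans e.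
  by apply: eq_bigr => j _; rewrite !(mxE _ _ j).
apply: eq_bigr => i _; apply: eq_bigr => j _.
have := H i j; rewrite -/P /=; case: eqP => [-> //|_ [-> _]].
by rewrite !mul0r !mulr0.
Qed.

Lemma Rtau_svd tau A U s V : is_svd A (U, s, V) ->
  Rtau tau A = \sum_(j < N) (tau ^+ 2 - Num.max (tau - s 0 j) 0 ^+ 2).
Proof.
move=> h; have := svdP A; rewrite /Rtau /sigma; case: (svd A) => [[U' s'] V'] h'.
exact: (@sum_svd_unique A _ _ _ _ _ _ (fun x => tau ^+ 2 - Num.max (tau - x) 0 ^+ 2) h' h).
Qed.

Lemma Sfun_svd (g : R -> R) A U s V : g 0 = 0 -> is_svd A (U, s, V) ->
  Sfun g A = U *m diag_mx (\row_j (g (s 0 j))%:C) *m V ^t*.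
Proof.
move=> g0 h; have := svdP A; rewrite /Sfun /sigma; case: (svd A) => [[U' s'] V'] h'.
have H := svd_intertwine h' h.
have [uU' uV' _ _] := h'; have [uU uV _ _] := h.
pose G s0 : 'M[R[i]]_N := diag_mx (\row_j (g (s0 0 j))%:C).
rewrite -!/(G _) /=.
have E : U ^t* *m U' *m G s' = G s *m (V ^t* *m V').
  apply/matrixP => i j; rewrite mul_mx_diag mul_diag_mx [LHS]mxE [RHS]mxE.
  rewrite [(\row_ _ _) 0 j]mxE [(\row_ _ _) 0 i]mxE.
  have := H i j; case: eqP => [<- [->|->]|_ [-> ->]].
  - by rewrite g0 mulr0 mul0r.
  - by rewrite mulrC.
  - by rewrite mul0r mulr0.
have UU : U *m U ^t* = 1%:M by exact/unitarymxP.
transitivity (U *m (U ^t* *m U' *m G s') *m V' ^t*).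
  by rewrite !mulmxA UU mul1mx.
by rewrite E -!mulmxA (unitarymxP uV') mulmx1.
Qed.

End SVD.

(* Main.v *)
Require Import Defs.
From mathcomp Require Import all_boot all_order all_algebra.
From mathcomp Require Import complex.
From mathcomp Require Import boolp classical_sets reals.
From mathcomp Require Import ring lra.

Set Implicit Arguments.
Unset Strict Implicit.
Unset Printing Implicit Defensive.

Import Order.TTheory GRing.Theory Num.Theory.

Local Open Scope ring_scope.
Local Open Scope complex_scope.
Local Open Scope sesquilinear_scope.
Local Open Scope classical_set_scope.

(** Write c(A) = R_tau(A) + |A|^2 for the convex part, and let psi be the
objective minus c on Hankel matrices, a quadratic function of the sequence a.

With h(x) = tau^2 - max(tau - x, 0)^2 + x^2 one has c(A) = sum_j h(sigma_j(A)).
The scalar Young inequality 2yx <= h(x) + k(y), k(y) = max(y, tau)^2 - tau^2,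
lifts to matrices, 2 Re<W, B> <= c(B) + sum_j k(sigma_j(W)), because the inner
product of two singular value decompositions is dominated by an average of the
products of their singular values over a doubly stochastic matrix
([rdot_svd_le], [convex_part_young]). Equality is reached for matrices with
common singular vectors. Hence c is a supremum of affine functions, so it is
convex, and 2W is a subgradient of c at A as soon as A and W have common
singular vectors and their singular values give equality in the scalar
inequality.

The function s_(tau,q) is built so that x |-> (s(x), (x - s(x))/(q - 1)) runs
through the equality cases. Thus W = S_s((q - 1)A + W) implies that 2W is a
subgradient of c at A. The converse follows from monotonicity of the
subdifferential: Z = (q - 1)A + W also decomposes as (q - 1)A' + W' with
W' = S_s(Z) and 2W' a subgradient at A', and two such decompositions agree
([half_subgradientP]).

For Hankel A, q U(F, A) = (q - 1)A - grad psi(A)/2. The two equations of a fixed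
point therefore say exactly that 2W is a subgradient of c at A on the whole
matrix space and that P_H(W) = - grad psi(A)/2 ([fixed_pointP]). Stationarity
is the same with a subgradient of the restriction of c to H. Projecting a
subgradient onto H gives one of the restriction; conversely a subgradient of
the restriction extends to the whole space by the Hahn-Banach argument
([hahn_banach_subgradient]). This gives the equivalence ([stationaryP]).

Finally the second-order part of psi is sum_l (mu_l - beta_l)|a_l|^2, which
gives the two convexity statements. *)

(** * The real inner product on matrices *)

Section RealInnerProduct.
Variables (R : realType) (N : nat).
Implicit Types (A B D : 'M[R[i]]_N) (t : R).

Lemma ReM_real t (z : R[i]) : complex.Re (t%:C * z) = t * complex.Re z.
Proof. by case: z => [a b] /=; rewrite mul0r subr0. Qed.

Lemma rdotDl A B D : rdot (A + B) D = rdot A D + rdot B D.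
Proof. by rewrite /rdot /fdot mulmxDl !raddfD. Qed.

Lemma rdotC A B : rdot A B = rdot B A.
Proof. by rewrite /rdot fdotC; case: (fdot B A). Qed.

Lemma rdotZl t A B : rdot (t%:C *: A) B = t * rdot A B.
Proof. by rewrite /rdot /fdot -scalemxAl linearZ /= ReM_real. Qed.

Lemma rdotDr A B D : rdot D (A + B) = rdot D A + rdot D B.
Proof. by rewrite !(rdotC D) rdotDl. Qed.

Lemma rdotZr t A B : rdot A (t%:C *: B) = t * rdot A B.
Proof. by rewrite !(rdotC A) rdotZl. Qed.

Lemma rdotNl A B : rdot (- A) B = - rdot A B.
Proof. by rewrite -scaleN1r -(rmorphN1 (real_complex R)) rdotZl mulN1r. Qed.

Lemma rdotNr A B : rdot A (- B) = - rdot A B.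
Proof. by rewrite !(rdotC A) rdotNl. Qed.

Definition rdotE := (rdotDl, rdotDr, rdotNl, rdotNr, rdotZl, rdotZr).

Lemma rdot0l A : rdot 0 A = 0.
Proof. by rewrite -(subrr 0) rdotDl rdotNl subrr. Qed.

Lemma rdot0r A : rdot A 0 = 0.
Proof. by rewrite rdotC rdot0l. Qed.

Lemma fdot_ge0 A : 0 <= fdot A A.
Proof.
rewrite fdotE; apply: sumr_ge0 => j _; apply: sumr_ge0 => k _.
exact: mul_conjC_ge0.
Qed.

Lemma fdot_rdot A : fdot A A = (rdot A A)%:C.
Proof. by rewrite /rdot RRe_real // ger0_real // fdot_ge0. Qed.

Lemma rdot_ge0 A : 0 <= rdot A A.
Proof. by rewrite -lecR -fdot_rdot fdot_ge0. Qed.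

Lemma rdot_eq0 A : rdot A A = 0 -> A = 0.
Proof. by move=> e; apply: fdot_eq0; rewrite fdot_rdot e. Qed.

Lemma fnorm_sqr A : fnorm A ^+ 2 = rdot A A.
Proof. by rewrite /fnorm sqr_sqrtr // rdot_ge0. Qed.

Lemma fnormZ t A : 0 <= t -> fnorm (t%:C *: A) = t * fnorm A.
Proof.
move=> t0; rewrite /fnorm !rdotE mulrA -expr2 sqrtrM ?sqr_ge0 //.
by rewrite sqrtr_sqr ger0_norm.
Qed.

Lemma fnorm_eq0 A : fnorm A = 0 -> A = 0.
Proof. by move=> h; apply: rdot_eq0; rewrite -fnorm_sqr h expr0n. Qed.

End RealInnerProduct.

(** * Hahn-Banach extension of a subgradient *)

Section SubgradientExtension.
Variables (R : realType) (N : nat).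
Implicit Types (A B G V X Y : 'M[R[i]]_N) (S : set 'M[R[i]]_N).

Definition real_subspace S :=
  forall (s t : R) X Y, S X -> S Y -> S (s%:C *: X + t%:C *: Y).

(** Keeping orthogonal projections along the induction spares dimension counting:
    a vector enters the subspace only through its component orthogonal to it. *)
Definition projectable S :=
  forall Y, exists2 X, S X & forall Z, S Z -> rdot (Y - X) Z = 0.

Definition add_line S V : set 'M[R[i]]_N :=
  [set Y | exists X t, S X /\ Y = X + t%:C *: V].

Lemma add_line_subspace S V : real_subspace S -> real_subspace (add_line S V).
Proof.
move=> hS s t _ _ [X [x [SX ->]]] [Y [y [SY ->]]].
exists (s%:C *: X + t%:C *: Y), (s * x + t * y); split; first exact: hS.
by rewrite rmorphD !rmorphM /= scalerDl !scalerDr !scalerA addrACA.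
Qed.

Lemma add_line_projectable S V : real_subspace S -> projectable S ->
  (forall X, S X -> rdot V X = 0) -> projectable (add_line S V).
Proof.
move=> hS pS oV Y; have [X SX oX] := pS Y.
pose t := rdot Y V / rdot V V.
exists (X + t%:C *: V); first by exists X, t.
move=> _ [Z [z [SZ ->]]]; have := oX _ SZ.
rewrite !rdotE (rdotC X V) (oV X SX) (oV Z SZ) => hZ.
have tV : t * rdot V V = rdot Y V.
  have [e|ne] := eqVneq (rdot V V) 0; last by rewrite divfK.
  by rewrite e mulr0 (rdot_eq0 e) rdot0r.
rewrite !mulr0 addr0 add0r; move: t tV hZ => t tV /subr0_eq ->; ring: tV.
Qed.

Variables (p : 'M[R[i]]_N -> R) (A : 'M[R[i]]_N).
Hypothesis p_convex : convex_on setT p.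

Definition subgradient S G := forall X, S X -> p A + rdot G X <= p (A + X).

(** The solvability condition for the value of the extended functional at V:
    every lower bound, coming from - s V, lies below every upper bound, coming
    from t V. The convex combination with weights s/(s + t) and t/(s + t) cancels
    V, and the subgradient inequality holds at the resulting point of S. *)
Lemma subgradient_slopes S G V X Y (s t : R) : real_subspace S ->
  subgradient S G -> S X -> S Y -> 0 < s -> 0 < t ->
  (p A + rdot G Y - p (A + Y - s%:C *: V)) / s <=
  (p (A + X + t%:C *: V) - p A - rdot G X) / t.
Proof.
move=> hS hG SX SY s0 t0; have st : 0 < s + t by apply: addr_gt0.
have stN : s + t != 0 by rewrite gt_eqF.
rewrite ler_pdivrMr // mulrAC ler_pdivlMr //.
have r01 : 0 <= s / (s + t) <= 1.
  apply/andP; split; first by rewrite divr_ge0 // ltW.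
  by rewrite ler_pdivrMr // mul1r lerDl ltW.
have := p_convex (A := A + X + t%:C *: V) (B := A + Y - s%:C *: V) I I r01.
have e1 : 1 - s / (s + t) = t / (s + t) by field.
rewrite e1.
have -> : (s / (s + t))%:C *: (A + X + t%:C *: V) +
    (t / (s + t))%:C *: (A + Y - s%:C *: V) =
    A + ((s / (s + t))%:C *: X + (t / (s + t))%:C *: Y).
  have -> : (t / (s + t))%:C = 1 - (s / (s + t))%:C :> R[i].
    by rewrite -e1 rmorphB.
  have hst : (s / (s + t))%:C * t%:C = (1 - (s / (s + t))%:C) * s%:C :> R[i].
    rewrite -(rmorph1 (real_complex R)) -rmorphB -!rmorphM /=; congr (_%:C); field.
    exact: stN.
  rewrite !scalerDr !scalerN !scalerA hst.
  apply/matrixP => i j; rewrite !mxE; ring.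
have := hG _ (hS (s / (s + t)) (t / (s + t)) _ _ SX SY).
rewrite !rdotE.
move=> h1 h2; have := le_trans h1 h2.
rewrite -(ler_pM2r st).
have -> : (p A + (s / (s + t) * rdot G X + t / (s + t) * rdot G Y)) * (s + t) =
  p A * (s + t) + s * rdot G X + t * rdot G Y by field.
set a := p (_ + _ + _); set b := p (_ - _).
have -> : (s / (s + t) * a + t / (s + t) * b) * (s + t) = s * a + t * b by field.
move=> h; nra.
Qed.

(** The extension takes at V the supremum c of the lower bounds. Since V is
    orthogonal to S, adding a multiple of V to G sets the value at V freely
    without changing the functional on S. *)
Lemma subgradient_add_line S G V : real_subspace S -> S 0 ->
  subgradient S G -> (forall X, S X -> rdot V X = 0) ->
  exists2 G', forall X, S X -> rdot G' X = rdot G X &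
    subgradient (add_line S V) G'.
Proof.
move=> hS S0 hG oV.
have [V0|VN0] := eqVneq (rdot V V) 0.
  exists G => // _ [X [t [SX ->]]].
  by rewrite (rdot_eq0 V0) scaler0 addr0; exact: hG.
pose L := [set r | exists Y (s : R), [/\ S Y, 0 < s &
  r = (p A + rdot G Y - p (A + Y - s%:C *: V)) / s]].
have L0 : nonempty L by eexists; exists 0, 1; split.
have Lub X (t : R) : S X -> 0 < t ->
    ubound L ((p (A + X + t%:C *: V) - p A - rdot G X) / t).
  by move=> SX t0 _ [Y [s [SY s0 ->]]]; exact: (subgradient_slopes V hS hG).
have supL : has_sup L by split => //; eexists; exact: (Lub 0 1).
pose c := sup L.
exists (G + ((c - rdot G V) / rdot V V)%:C *: V) => [X SX|_ [X [t [SX ->]]]].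
  by rewrite !rdotE (oV X SX) mulr0 addr0.
rewrite !rdotE (oV X SX) mulr0 add0r addrA.
have -> : p A + (rdot G X + t * rdot G V) +
    (c - rdot G V) / rdot V V * (t * rdot V V) = p A + rdot G X + t * c by field.
rewrite [A + _]addrA.
case: (ltgtP t 0) => [t0|t0|->].
- have : c >= (p A + rdot G X - p (A + X - (- t)%:C *: V)) / (- t).
    apply: sup_upper_bound => //; exists X, (- t); by rewrite oppr_gt0; split.
  rewrite ler_pdivrMr ?oppr_gt0 // rmorphN /= scaleNr opprK; lra.
- have : c <= (p (A + X + t%:C *: V) - p A - rdot G X) / t.
    by apply: ge_sup => //; exact: Lub.
  rewrite ler_pdivlMr //; lra.
- by rewrite rmorph0 scale0r addr0 mul0r addr0; exact: hG.
Qed.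

(** The extended subspace can only be described by what it contains, as a vector
    of the list may already lie in the span of the previous ones. *)
Lemma subgradient_extend S G (es : seq 'M[R[i]]_N) :
  real_subspace S -> S 0 -> projectable S -> subgradient S G ->
  exists S' G', [/\ real_subspace S', S `<=` S', (forall E, E \in es -> S' E),
    (forall X, S X -> rdot G' X = rdot G X) & subgradient S' G'].
Proof.
elim: es S G => [|E es IH] S G hS S0 pS hG.
  by exists S, G; split.
have [E' SE' oE'] := pS E.
have [G1 G1G hG1] := subgradient_add_line hS S0 hG oE'.
pose S1 := add_line S (E - E').
have sub : S `<=` S1 by move=> X SX; exists X, 0; rewrite rmorph0 scale0r addr0.
have S1E : S1 E by exists E', 1; split=> //; rewrite rmorph1 scale1r addrC subrK.
have [S' [G' [hS' sS1 es' G'G1 hG']]] := IH S1 G1 (add_line_subspace hS)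
  (sub _ S0) (add_line_projectable hS pS oE') hG1.
exists S', G'; split=> // [X /sub /sS1 //|F|X SX].
  by rewrite inE => /predU1P[->|/es' //]; apply: sS1.
by rewrite G'G1 ?G1G //; exact: sub.
Qed.

Lemma real_subspace_sum S (I : Type) (r : seq I) (F : I -> 'M[R[i]]_N) :
  real_subspace S -> S 0 -> (forall i, S (F i)) -> S (\sum_(i <- r) F i).
Proof.
move=> hS S0 hF; elim/big_ind: _ => // X Y SX SY.
by have := hS 1 1 _ _ SX SY; rewrite rmorph1 !scale1r.
Qed.

(** Continuity is not an issue: a finite spanning family exhausts the space. *)
Theorem hahn_banach_subgradient S G :
  real_subspace S -> S 0 -> projectable S -> subgradient S G ->
  exists2 G', forall X, S X -> rdot G' X = rdot G X & subgradient setT G'.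
Proof.
move=> hS S0 pS hG.
(* A real spanning family: the matrix units and their multiples by 'i. *)
pose e (x : 'I_N * 'I_N) : 'M[R[i]]_N := delta_mx x.1 x.2.
have [S' [G' [hS' sS es' G'G hG']]] :=
  subgradient_extend (map e (enum {: 'I_N * 'I_N}) ++
    map (fun x => 'i *: e x) (enum {: 'I_N * 'I_N})) hS S0 pS hG.
exists G' => // X _; apply: hG'.
have S'0 := sS _ S0.
have S'e x : S' (e x) by apply: es'; rewrite mem_cat map_f ?mem_enum.
have S'ie x : S' ('i *: e x).
  by apply: es'; rewrite mem_cat (map_f (fun x => 'i *: e x)) ?mem_enum ?orbT.
rewrite [X]matrix_sum_delta pair_big /=.
apply: real_subspace_sum => // -[j k] /=.
have := hS' (complex.Re (X j k)) (complex.Im (X j k)) _ _ (S'e (j, k)) (S'ie (j, k)).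
rewrite scalerA -scalerDl; congr (S' (_ *: _)).
by rewrite [RHS]complexE mulrC.
Qed.

End SubgradientExtension.

(** * A trace inequality for singular value decompositions *)

Section TraceInequality.
Variables (R : realType) (N : nat).
Implicit Types (A B W U V P Q : 'M[R[i]]_N) (w b : 'rV[R]_N).

Let sqmod (z : R[i]) : R := complex.Re (z * z^*).

Lemma unitary_row_sum P i : P \is unitarymx -> \sum_j sqmod (P i j) = 1.
Proof.
move=> uP; rewrite /sqmod -(raddf_sum (@complex.Re R)).
have := congr1 (fun X : 'M_N => X i i) (unitarymxP uP).
rewrite [LHS]mxE [RHS]mxE eqxx => e.
rewrite -[RHS](_ : complex.Re (1%:R : R[i]) = 1) // -e.
by congr complex.Re; apply: eq_bigr => j _; rewrite !mxE.
Qed.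

Lemma unitary_col_sum P j : P \is unitarymx -> \sum_i sqmod (P i j) = 1.
Proof.
move=> uP; rewrite -(@unitary_row_sum (P ^t*) j) ?trmxC_unitary //.
by apply: eq_bigr => i _; rewrite !mxE /sqmod conjCK mulrC.
Qed.

Lemma fdot_svd W U1 w V1 B U2 b V2 :
  is_svd W (U1, w, V1) -> is_svd B (U2, b, V2) ->
  fdot W B = \sum_i \sum_j
    (w 0 j * b 0 i)%:C * ((U2 ^t* *m U1) i j * ((V2 ^t* *m V1) i j)^*).
Proof.
have adjM (X Y : 'M[R[i]]_N) : (X *m Y) ^t* = Y ^t* *m X ^t*.
  by rewrite trmx_mul map_mxM.
move=> [_ _ _ ->] [_ _ _ ->]; rewrite /fdot.
set S1 := diag_mx _; set S2 := diag_mx _.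
have adjS2 : S2 ^t* = S2.
  rewrite /S2 tr_diag_mx map_diag_mx; congr diag_mx; apply/rowP => k.
  by rewrite !mxE; exact: conjc_real.
have -> : (U2 *m S2 *m V2 ^t*) ^t* = V2 *m S2 *m U2 ^t*.
  by rewrite (adjM _ (V2 ^t*)) (trmxCK V2) (adjM U2) adjS2 mulmxA.
rewrite !mulmxA mxtrace_mulC !mulmxA -2!mulmxA [V1 ^t* *m _]mulmxA mulmxA.
rewrite -[_ *m S2]mulmxA /mxtrace; apply: eq_bigr => i _.
rewrite mxE; apply: eq_bigr => j _.
rewrite mul_mx_diag mul_mx_diag [X in X * _]mxE [X in _ * X]mxE.
rewrite !(mxE _ _ 0).
have -> : (V1 ^t* *m V2) j i = ((V2 ^t* *m V1) i j)^*.
  rewrite -[V1 ^t* *m V2](_ : (V2 ^t* *m V1) ^t* = _) ?mxE //.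
  by rewrite trmx_mul map_mxM trmxCK.
by rewrite rmorphM /=; ring.
Qed.

Lemma Re_mul_conj_le (x y : R[i]) :
  complex.Re (x * y^*) <= (sqmod x + sqmod y) / 2.
Proof.
rewrite /sqmod; case: x y => [a b] [c d] /=.
have := sqr_ge0 (a - c); have := sqr_ge0 (b - d); nra.
Qed.

Lemma sqmod_ge0 (z : R[i]) : 0 <= sqmod z.
Proof. by case: z => [a b]; rewrite /sqmod /=; nra. Qed.

(** The weights are M i j = (|P i j|^2 + |Q i j|^2) / 2 for the unitary matrices
    P = U2^t* U1 and Q = V2^t* V1. This takes the place of von Neumann's trace
    inequality and needs no ordering of the singular values. *)
Lemma rdot_svd_le W U1 w V1 B U2 b V2 :
  is_svd W (U1, w, V1) -> is_svd B (U2, b, V2) ->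
  exists M : 'M[R]_N, [/\ forall i j, 0 <= M i j,
    forall i, \sum_j M i j = 1, forall j, \sum_i M i j = 1 &
    rdot W B <= \sum_i \sum_j M i j * (w 0 j * b 0 i)].
Proof.
move=> hW hB; have [uU1 uV1 w0 _] := hW; have [uU2 uV2 b0 _] := hB.
pose P := U2 ^t* *m U1; pose Q := V2 ^t* *m V1.
have uP : P \is unitarymx.
  exact: mul_unitarymx (etrans (trmxC_unitary U2) uU2) uU1.
have uQ : Q \is unitarymx.
  exact: mul_unitarymx (etrans (trmxC_unitary V2) uV2) uV1.
exists (\matrix_(i, j) ((sqmod (P i j) + sqmod (Q i j)) / 2)); split.
- by move=> i j; rewrite mxE divr_ge0 // addr_ge0 // sqmod_ge0.
- move=> i; under eq_bigr do rewrite mxE.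
  by rewrite -mulr_suml big_split /= (unitary_row_sum i uP) (unitary_row_sum i uQ)
    -(natrD _ 1 1) divff // pnatr_eq0.
- move=> j; under eq_bigr do rewrite mxE.
  by rewrite -mulr_suml big_split /= (unitary_col_sum j uP) (unitary_col_sum j uQ)
    -(natrD _ 1 1) divff // pnatr_eq0.
rewrite /rdot (fdot_svd hW hB) raddf_sum; apply: ler_sum => i _.
rewrite raddf_sum; apply: ler_sum => j _.
rewrite [leLHS]ReM_real [X in _ <= X * _]mxE mulrC ler_wpM2r ?mulr_ge0 //.
exact: Re_mul_conj_le.
Qed.

Lemma rdot_joint_svd W B U V w b :
  is_svd W (U, w, V) -> is_svd B (U, b, V) -> rdot W B = \sum_j w 0 j * b 0 j.
Proof.
move=> hW hB; have [uU uV _ _] := hW.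
have UU : U ^t* *m U = 1%:M.
  by have := unitarymxP (etrans (trmxC_unitary U) uU); rewrite trmxCK.
have VV : V ^t* *m V = 1%:M.
  by have := unitarymxP (etrans (trmxC_unitary V) uV); rewrite trmxCK.
rewrite /rdot (fdot_svd hW hB) UU VV raddf_sum; apply: eq_bigr => i _.
rewrite raddf_sum (bigD1 i) //= big1 ?addr0 => [|j ji].
  by rewrite [LHS]ReM_real mxE eqxx conjC1 mulr1 /= mulr1.
by rewrite mxE eq_sym (negbTE ji) mul0r mulr0.
Qed.

End TraceInequality.

(** * Fenchel-Young inequality for the convex part *)

Section FenchelYoung.
Variables (R : realType) (N : nat) (tau : R).
Hypothesis tau_gt0 : 0 < tau.
Implicit Types (A B W U V : 'M[R[i]]_N) (w b : 'rV[R]_N).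

Definition penalty (x : R) : R := tau ^+ 2 - Num.max (tau - x) 0 ^+ 2 + x ^+ 2.
(** On y >= 0 this is sup over x >= 0 of 2 y x - penalty x. *)
Definition penalty_conj (y : R) : R := Num.max y tau ^+ 2 - tau ^+ 2.

Lemma penaltyE (x : R) : 0 <= x ->
  penalty x = if x <= tau then 2 * tau * x else tau ^+ 2 + x ^+ 2.
Proof.
move=> x0; rewrite /penalty; have [h|h] := leP x tau.
  rewrite max_l; last by lra.
  ring.
rewrite max_r; last by lra.
ring.
Qed.

Lemma penalty_young (x y : R) : 0 <= x -> 0 <= y ->
  2 * (y * x) <= penalty x + penalty_conj y.
Proof.
move=> x0 y0; rewrite penaltyE // /penalty_conj.
have sq := sqr_ge0 (x - y).
case: (leP x tau) => h1; case: (leP y tau) => h2.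
- have := mulr_ge0 x0 (_ : 0 <= tau - y); rewrite subr_ge0 => /(_ h2); nra.
- have := mulr_ge0 (_ : 0 <= y - tau) (_ : 0 <= tau - x).
  rewrite !subr_ge0 => /(_ (ltW h2) h1); have := sqr_ge0 (y - tau); nra.
- have := mulr_ge0 (_ : 0 <= tau - y) (addr_ge0 (ltW tau_gt0) y0).
  rewrite !subr_ge0 => /(_ h2); nra.
- nra.
Qed.

Lemma convex_part_svd A U b V : is_svd A (U, b, V) ->
  convex_part tau A = \sum_j penalty (b 0 j).
Proof.
move=> hA; rewrite /convex_part (Rtau_svd tau hA) fnorm_sqr.
rewrite (rdot_joint_svd hA hA) -big_split /=; apply: eq_bigr => j _.
by rewrite -expr2.
Qed.

(** The scalar inequality is averaged over a doubly stochastic matrix, whose unit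
    row and column sums decouple the two families of singular values. *)
Lemma convex_part_young W U w V B : is_svd W (U, w, V) ->
  2 * rdot W B <= convex_part tau B + \sum_j penalty_conj (w 0 j).
Proof.
case: (svd_exists B) => -[[U2 b] V2] hB hW.
rewrite (convex_part_svd hB).
have [M [M0 Mr Mc le]] := rdot_svd_le hW hB.
have [_ _ w0 _] := hW; have [_ _ b0 _] := hB.
apply: (@le_trans _ _ (\sum_i \sum_j
    M i j * (penalty (b 0 i) + penalty_conj (w 0 j)))).
  apply: le_trans (_ : 2 * _ <= _); first exact: ler_wpM2l le.
  rewrite mulr_sumr; apply: ler_sum => i _; rewrite mulr_sumr; apply: ler_sum => j _.
  by rewrite mulrCA ler_wpM2l // penalty_young.
under eq_bigr do under eq_bigr do rewrite mulrDr.
under eq_bigr do rewrite big_split /= -mulr_suml Mr mul1r.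
rewrite big_split /= lerD2l exchange_big /=.
by under eq_bigr do rewrite -mulr_suml Mc mul1r.
Qed.

(** The singular values max(b, tau) of W solve 2 w b = penalty b + penalty_conj w:
    they are half of a subgradient of the penalty at b. *)
Lemma convex_part_attained A U b V : is_svd A (U, b, V) ->
  exists W (w : 'rV[R]_N), is_svd W (U, w, V) /\
    2 * rdot W A = convex_part tau A + \sum_j penalty_conj (w 0 j).
Proof.
move=> hA; have [uU uV b0 _] := hA.
pose w := \row_j Num.max (b 0 j) tau : 'rV[R]_N.
have hW : is_svd (U *m diag_mx (map_mx (real_complex R) w) *m V ^t*) (U, w, V).
  by split=> // j; rewrite mxE le_max b0.
eexists; exists w; split; first exact: hW.
rewrite (rdot_joint_svd hW hA) (convex_part_svd hA) mulr_sumr -big_split /=.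
apply: eq_bigr => j _; rewrite /w mxE penaltyE // /penalty_conj.
by case: (leP (b 0 j) tau) => h; rewrite ?maxxx ?(max_l (ltW h)); ring.
Qed.

(** By the two previous lemmas the convex part is a maximum of affine functions;
    the one that is active at the convex combination bounds both end points. *)
Lemma convex_part_convex : convex_on setT (@convex_part R N tau).
Proof.
move=> A B t _ _ /andP[t0 t1].
have [[[U b] V] hX] := svd_exists (t%:C *: A + (1 - t)%:C *: B).
have [W [w [hW e]]] := convex_part_attained hX.
move: e; rewrite rdotDr !rdotZr => e.
have hA := convex_part_young A hW; have hB := convex_part_young B hW.
have t1' : 0 <= 1 - t by rewrite subr_ge0.
move: (ler_wpM2l t0 hA) (ler_wpM2l t1' hB) e.
clear hX hW hA hB.
move: (convex_part tau _) (convex_part tau A) (convex_part tau B) => cX cA cB.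
move: (rdot W A) (rdot W B) (\sum_j _) => rA rB k; lra.
Qed.

Lemma joint_svd_subgradient A W U a w V :
  is_svd A (U, a, V) -> is_svd W (U, w, V) ->
  (forall j, 2 * (w 0 j * a 0 j) = penalty (a 0 j) + penalty_conj (w 0 j)) ->
  forall B, convex_part tau A + 2 * rdot W (B - A) <= convex_part tau B.
Proof.
move=> hA hW e B; have := convex_part_young B hW.
have : 2 * rdot W A = convex_part tau A + \sum_j penalty_conj (w 0 j).
  rewrite (rdot_joint_svd hW hA) (convex_part_svd hA) mulr_sumr -big_split /=.
  exact: eq_bigr.
rewrite rdotDr rdotNr; clear hA hW e.
move: (convex_part _ _) (convex_part _ _) (rdot W A) (rdot W B) (\sum_j _).
by move=> c c' x y k; lra.
Qed.

End FenchelYoung.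

(** * Subgradients as fixed points of a singular value map *)

Section Resolvent.
Variables (R : realType) (N : nat) (tau q : R).
Hypotheses (tau_gt0 : 0 < tau) (q_gt1 : 1 < q).
Implicit Types (A B W Z U V : 'M[R[i]]_N).

(** The three cases x <= tau, tau <= x <= q tau and x >= q tau give (y, z) equal to
    (x, 0), (tau, z) with z <= tau, and (x/q, x/q). *)
Lemma s_fun_young (x : R) : 0 <= x ->
  let y := s_fun tau q x in let z := (x - y) / (q - 1) in
  [/\ 0 <= y, 0 <= z & 2 * (y * z) = penalty tau z + penalty_conj tau y].
Proof.
move=> x0 y z.
have q0 : 0 < q := lt_trans ltr01 q_gt1.
have q1 : 0 < q - 1 by rewrite subr_gt0.
have q1N : q - 1 != 0 by rewrite gt_eqF.
have qN : q != 0 by rewrite gt_eqF.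
have xq : x / q * q = x by rewrite divfK.
have xq0 : 0 <= x / q by rewrite divr_ge0 // ltW.
have [xt|tx] := leP x tau.
  have ye : y = x.
    by rewrite /y /s_fun min_l // max_l // ler_pdivrMr // ler_peMr // ltW.
  have ze : z = 0 by rewrite /z ye subrr mul0r.
  rewrite ye ze penaltyE // (ltW tau_gt0) /penalty_conj.
  rewrite max_r //; split=> //; ring.
have ye : y = Num.max tau (x / q) by rewrite /y /s_fun min_r // ltW.
have [h|h] := leP (x / q) tau.
  have yt : y = tau by rewrite ye max_l.
  have z0 : 0 <= z by rewrite /z yt divr_ge0 // ?subr_ge0 ltW.
  have zt : z <= tau.
    rewrite /z yt ler_pdivrMr //; nra.
  rewrite yt penaltyE // zt /penalty_conj maxxx; split=> //; [exact: ltW|ring].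
have yx : y = x / q by rewrite ye max_r // ltW.
have zy : z = y by rewrite /z yx; field; rewrite ?q1N ?qN.
have y0 : 0 <= y by rewrite yx.
rewrite zy penaltyE // yx (lt_geF h) /penalty_conj max_l; last exact: ltW.
by split=> //; ring.
Qed.

(** 2 W is a subgradient of the convex part at A on the whole matrix space; the
    factor 2 makes W itself, rather than its double, satisfy the fixed point
    equation. *)
Definition half_subgradient A W :=
  forall B, convex_part tau A + 2 * rdot W (B - A) <= convex_part tau B.

Lemma s_fun0 : s_fun tau q 0 = 0.
Proof. by rewrite /s_fun min_l ?mul0r ?maxxx // ltW. Qed.

Lemma Sfun_half_subgradient Z :
  let W := Sfun (s_fun tau q) Z in
  half_subgradient ((q - 1)^-1%:C *: (Z - W)) W.
Proof.
have [[[U s] V] hZ] := svd_exists Z; have [uU uV s_ge0 eZ] := hZ.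
rewrite /= (Sfun_svd s_fun0 hZ).
pose w : 'rV[R]_N := \row_j s_fun tau q (s 0 j).
pose a : 'rV[R]_N := \row_j ((s 0 j - s_fun tau q (s 0 j)) / (q - 1)).
have -> : \row_j (s_fun tau q (s 0 j))%:C = map_mx (real_complex R) w.
  by apply/rowP => j; rewrite !mxE.
have -> : (q - 1)^-1%:C *: (Z - U *m diag_mx (map_mx (real_complex R) w) *m V ^t*) =
    U *m diag_mx (map_mx (real_complex R) a) *m V ^t*.
  rewrite {1}eZ -mulmxBl -mulmxBr scalemxAl scalemxAr -linearB -linearZ /=.
  congr (_ *m diag_mx _ *m _); apply/rowP => j.
  by rewrite !mxE mulrC [RHS]rmorphM rmorphB.
have young j := s_fun_young (s_ge0 j).
apply: (joint_svd_subgradient tau_gt0 (U := U) (a := a) (w := w) (V := V)).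
- split; [exact: uU|exact: uV| |exact: erefl].
  by move=> j; rewrite mxE; have [] := young j.
- split; [exact: uU|exact: uV| |exact: erefl].
  by move=> j; rewrite mxE; have [] := young j.
- by move=> j; rewrite !mxE; have [] := young j.
Qed.

Lemma half_subgradient_monotone A W A' W' :
  half_subgradient A W -> half_subgradient A' W' ->
  0 <= rdot (W - W') (A - A').
Proof.
move=> /(_ A') h /(_ A) h'; move: h h'; rewrite !rdotE.
move: (convex_part _ _) (convex_part _ _) => c c'.
move: (rdot W A) (rdot W A') (rdot W' A) (rdot W' A') => x y z t; lra.
Qed.

(** Any A' and W' with (q - 1) A' + W' = (q - 1) A + W satisfy
    W - W' = - (q - 1)(A - A'); if both pairs are subgradient pairs, monotonicity
    forces A = A'. This avoids computing the subdifferential. *)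
Lemma half_subgradientP A W :
  half_subgradient A W <-> W = Sfun (s_fun tau q) ((q - 1)%:C *: A + W).
Proof.
have q1 : 0 < q - 1 by rewrite subr_gt0.
have qC : (q - 1)^-1%:C * (q - 1)%:C = 1 :> R[i].
  by rewrite -rmorphM /= mulVf // gt_eqF.
set Z := _ + W; pose W' := Sfun (s_fun tau q) Z.
pose A' := (q - 1)^-1%:C *: (Z - W').
have sub' : half_subgradient A' W' by exact: Sfun_half_subgradient.
split=> [sub|eW]; last first.
  have -> : A = A' by rewrite /A' /W' -eW /Z addrK scalerA qC scale1r.
  by rewrite eW.
have eWA : W - W' = - ((q - 1)%:C *: (A - A')).
  rewrite scalerBr /A' scalerA mulrC qC scale1r /Z.
  by apply/matrixP => i j; rewrite !mxE; ring.
have := half_subgradient_monotone sub sub'; rewrite eWA rdotNl rdotZl => h.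
have d0 : rdot (A - A') (A - A') = 0.
  by move: h (rdot_ge0 (A - A')); move: (rdot _ _) => d; nra.
by apply/eqP; rewrite -subr_eq0 eWA (rdot_eq0 d0) scaler0 oppr0.
Qed.

End Resolvent.

(** * Hankel matrices *)

Section HankelSubspace.
Variables (R : realType) (N : nat).
Implicit Types (A X Y : 'M[R[i]]_N) (a b : 'rV[R[i]]_(2 * N - 1)).

Lemma LamB a b : Lam (a - b) = Lam a - Lam b.
Proof. by apply/matrixP => j k; rewrite !mxE. Qed.

Lemma LamD a b : Lam (a + b) = Lam a + Lam b.
Proof. by apply/matrixP => j k; rewrite !mxE. Qed.

Lemma LamZ (c : R[i]) a : Lam (c *: a) = c *: Lam a.
Proof. by apply/matrixP => j k; rewrite !mxE. Qed.

Lemma hankel_subspace : real_subspace (hankel R N).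
Proof.
by move=> s t X Y /Lam_invK <- /Lam_invK <-; rewrite -!LamZ -LamD; exact: Lam_hankel.
Qed.

Lemma hankel0 : hankel R N 0.
Proof. by move=> j k j' k' _; rewrite !mxE. Qed.

Lemma hankelB X Y : hankel R N X -> hankel R N Y -> hankel R N (X - Y).
Proof. by move=> /Lam_invK <- /Lam_invK <-; rewrite -LamB; exact: Lam_hankel. Qed.

Lemma hankelD X Y : hankel R N X -> hankel R N Y -> hankel R N (X + Y).
Proof. by move=> /Lam_invK <- /Lam_invK <-; rewrite -LamD; exact: Lam_hankel. Qed.

Lemma rdot_Lam_inv A X : hankel R N X -> rdot (Lam (Lam_inv A)) X = rdot A X.
Proof.
move=> hX; have := congr1 (@complex.Re R) (@Lam_inv_orth R N A X hX).
rewrite -[complex.Re (fdot _ _)]/(rdot _ _) rdotDl rdotNl => /subr0_eq ->.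
by [].
Qed.

Lemma hankel_projectable : projectable (hankel R N).
Proof.
move=> Y; exists (Lam (Lam_inv Y)); first exact: Lam_hankel.
by move=> X hX; rewrite rdotDl rdotNl rdot_Lam_inv // subrr.
Qed.

Lemma hankel_proj_unique A X : hankel R N X ->
  (forall Y, hankel R N Y -> rdot A Y = rdot X Y) -> Lam (Lam_inv A) = X.
Proof.
move=> hX eX; apply/eqP; rewrite -subr_eq0; apply/eqP/rdot_eq0.
have hD : hankel R N (Lam (Lam_inv A) - X) by apply: hankelB => //; exact: Lam_hankel.
by rewrite rdotDl rdotNl rdot_Lam_inv // eX // subrr.
Qed.

Lemma Lam_adj_Lam a l : Lam_adj (Lam a) 0 l = (beta R l)%:C * a 0 l.
Proof.
rewrite -{2}[a]LamK !(mxE _ _ 0 l) mulrA -rmorphM /= mulfV ?mul1r //.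
by rewrite gt_eqF // beta_gt0.
Qed.

Lemma rdot_Lam a b :
  rdot (Lam a) (Lam b) = \sum_l beta R l * complex.Re (a 0 l * (b 0 l)^*).
Proof.
rewrite /rdot fdot_Lam_adj raddf_sum; apply: eq_bigr => l _.
by rewrite Lam_adj_Lam -mulrA [LHS]ReM_real.
Qed.

End HankelSubspace.

(** * The smooth part of the objective *)

Section SmoothPart.
Variables (R : realType) (N : nat) (tau : R) (mu : 'rV[R]_(2 * N - 1)).
Variable f : 'rV[R[i]]_(2 * N - 1).
Implicit Types (A B G H : 'M[R[i]]_N) (a b : 'rV[R[i]]_(2 * N - 1)).

Lemma normc_sqr (z : R[i]) :
  Normc.normc z ^+ 2 = complex.Re z ^+ 2 + complex.Im z ^+ 2.
Proof. by case: z => [x y] /=; rewrite sqr_sqrtr // addr_ge0 ?sqr_ge0. Qed.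

Lemma Re_mul_conj (z w : R[i]) : complex.Re (z * w^*) =
  complex.Re z * complex.Re w + complex.Im z * complex.Im w.
Proof. by case: z w => [x y] [u v] /=; rewrite mulrN opprK. Qed.

(** The objective minus the convex part: R_tau cancels, and |Lam a|^2 is the sum of
    beta_l |a_l|^2. *)
Definition smooth_part a : R :=
  \sum_l (mu 0 l * Normc.normc (a 0 l - f 0 l) ^+ 2
          - beta R l * Normc.normc (a 0 l) ^+ 2).

Definition curvature a : R :=
  \sum_l (mu 0 l - beta R l) * Normc.normc (a 0 l) ^+ 2.

(** The division by beta turns the gradient with respect to a into the one for the
    Frobenius inner product of the matrices Lam a. *)
Definition smooth_grad a : 'rV[R[i]]_(2 * N - 1) :=
  \row_l (2%:C * ((mu 0 l / beta R l)%:C * (a 0 l - f 0 l) - a 0 l)).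

Lemma fnorm_Lam a : fnorm (Lam a) ^+ 2 = \sum_l beta R l * Normc.normc (a 0 l) ^+ 2.
Proof.
rewrite fnorm_sqr rdot_Lam; apply: eq_bigr => l _.
by rewrite Re_mul_conj normc_sqr !expr2.
Qed.

Lemma objectiveH_Lam a :
  objectiveH tau mu f (Lam a) = convex_part tau (Lam a) + smooth_part a.
Proof.
rewrite /objectiveH LamK /objective /convex_part fnorm_Lam -addrA; congr (_ + _).
by rewrite -big_split /=; apply: eq_bigr => l _; rewrite addrC subrK.
Qed.

Lemma smooth_part_expand a b :
  smooth_part b - smooth_part a - rdot (Lam (smooth_grad a)) (Lam (b - a)) =
  curvature (b - a).
Proof.
rewrite rdot_Lam /smooth_part /curvature -!sumrB; apply: eq_bigr => l _.
rewrite !mxE Re_mul_conj !normc_sqr.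
have bN : beta R l != 0 by rewrite gt_eqF // beta_gt0.
case: (a 0 l) (b 0 l) (f 0 l) => [x y] [u v] [g h] /=.
by field.
Qed.

Lemma curvature_bound : exists2 K, 0 < K &
  forall a, `|curvature a| <= K * fnorm (Lam a) ^+ 2.
Proof.
pose K := \sum_l `|mu 0 l - beta R l| / beta R l.
have K_ge l : `|mu 0 l - beta R l| / beta R l <= K.
  rewrite /K (bigD1 l) //= lerDl sumr_ge0 // => k _.
  by rewrite divr_ge0 // ltW // beta_gt0.
exists (K + 1) => [|a].
  rewrite ltr_pwDr // sumr_ge0 // => k _.
  by rewrite divr_ge0 // ltW // beta_gt0.
rewrite fnorm_Lam mulr_sumr; apply: le_trans (ler_norm_sum _ _ _) _.
apply: ler_sum => l _; rewrite normrM [X in _ * X]ger0_norm ?sqr_ge0 // [leRHS]mulrA.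
rewrite ler_wpM2r ?sqr_ge0 //.
rewrite -ler_pdivrMr ?beta_gt0 //; apply: le_trans (K_ge l) _.
by rewrite lerDl.
Qed.

Lemma smooth_is_gradient a :
  is_gradient (hankel R N)
    (fun B => objectiveH tau mu f B - convex_part tau B)
    (Lam a) (Lam (smooth_grad a)).
Proof.
split=> [|eps eps0]; first exact: Lam_hankel.
have [K K0 hK] := curvature_bound.
have smoothE c : objectiveH tau mu f (Lam c) - convex_part tau (Lam c) = smooth_part c.
  by rewrite objectiveH_Lam addrC addKr.
exists (eps / K) => [|B hB]; first exact: divr_gt0.
rewrite -(Lam_invK hB); set b := Lam_inv B; rewrite -LamB => small.
rewrite 2!smoothE smooth_part_expand.
apply: le_trans (hK _) _; rewrite expr2 mulrA ler_wpM2r ?sqrtr_ge0 //.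
by rewrite mulrC -ler_pdivlMr // ltW.
Qed.

End SmoothPart.

(** * Uniqueness of the gradient on a subspace *)

Section GradientUniqueness.
Variables (R : realType) (N : nat).
Implicit Types (A B G H : 'M[R[i]]_N) (S : set 'M[R[i]]_N).

(** Both first-order expansions are compared at A + t (G - H), with error
    eps = |G - H| / 4: their difference t |G - H|^2 is then at most half of itself. *)
Lemma is_gradient_unique S psi A G H : real_subspace S -> S A ->
  is_gradient S psi A G -> is_gradient S psi A H -> G = H.
Proof.
have halve (x g h t d : R) : x - t * h <= d / 4 * (t * d) ->
    - (d / 4 * (t * d)) <= x - t * g -> t * g - t * h = t * d ^+ 2 ->
    t * d ^+ 2 <= t * (d ^+ 2 / 2) by lra.
move=> hS SA [SG hG] [SH hH]; pose D := G - H.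
have [D0|DN0] := eqVneq (fnorm D) 0.
  by apply/eqP; rewrite -subr_eq0; apply/eqP/fnorm_eq0.
have D_gt0 : 0 < fnorm D by rewrite lt0r DN0 sqrtr_ge0.
have eps0 : 0 < fnorm D / 4 by rewrite divr_gt0.
have [d1 d1_gt0 h1] := hG _ eps0; have [d2 d2_gt0 h2] := hH _ eps0.
(* This puts B at distance min(d1, d2) / 2 from A. *)
pose t := Num.min d1 d2 / (2 * fnorm D).
have m0 : 0 < Num.min d1 d2 by rewrite lt_min d1_gt0.
have t0 : 0 < t by rewrite divr_gt0 // mulr_gt0.
pose B := A + t%:C *: D.
have SB : S B.
  have := hS 1 1 _ _ SA (hS t (- t) _ _ SG SH).
  by rewrite !rmorph1 !scale1r rmorphN /= scaleNr -scalerBr.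
have BA : B - A = t%:C *: D by rewrite /B addrC addKr.
have nBA : fnorm (B - A) = t * fnorm D by rewrite BA fnormZ // ltW.
have nBAe : fnorm (B - A) = Num.min d1 d2 / 2 by rewrite nBA /t; field.
have small : fnorm (B - A) < Num.min d1 d2.
  by rewrite nBAe ltr_pdivrMr // ltr_pMr // ltr1n.
have [s1 s2] : fnorm (B - A) < d1 /\ fnorm (B - A) < d2.
  by move: small; rewrite lt_min => /andP[].
have := h1 B SB s1; have := h2 B SB s2.
rewrite nBA BA !rdotZr !ler_norml => /andP[_ u] /andP[l _].
have e : t * rdot G D - t * rdot H D = t * fnorm D ^+ 2.
  by rewrite fnorm_sqr {3}/D rdotDl rdotNl mulrBr.
have : t * fnorm D ^+ 2 <= t * (fnorm D ^+ 2 / 2).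
  exact: halve u l e.
by rewrite ler_pM2l // leNgt ltr_pdivrMr // ltr_pMr ?exprn_gt0 // ltr1n.
Qed.

End GradientUniqueness.

(** * The objective and the fixed points *)

Section Objective.
Variables (R : realType) (N : nat) (tau q : R) (mu : 'rV[R]_(2 * N - 1)).
Variable f : 'rV[R[i]]_(2 * N - 1).
Hypotheses (tau_gt0 : 0 < tau) (q_gt1 : 1 < q).
Implicit Types (A B W : 'M[R[i]]_N) (a b : 'rV[R[i]]_(2 * N - 1)).

Lemma smooth_part_affine a b (t : R) :
  smooth_part mu f (t%:C *: a + (1 - t)%:C *: b) =
  t * smooth_part mu f a + (1 - t) * smooth_part mu f b
  - t * (1 - t) * curvature mu (a - b).
Proof.
rewrite /smooth_part /curvature !mulr_sumr -big_split -sumrB /=.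
apply: eq_bigr => l _; rewrite !mxE !normc_sqr.
by case: (a 0 l) (b 0 l) (f 0 l) => [x y] [u v] [g h] /=; ring.
Qed.

Lemma objectiveH_convexity_defect a b (t : R) : 0 <= t <= 1 ->
  objectiveH tau mu f (t%:C *: Lam a + (1 - t)%:C *: Lam b) <=
  t * objectiveH tau mu f (Lam a) + (1 - t) * objectiveH tau mu f (Lam b)
  - t * (1 - t) * curvature mu (a - b).
Proof.
move=> t01; have := convex_part_convex tau_gt0 (A := Lam a) (B := Lam b) I I t01.
rewrite -!LamZ -LamD !objectiveH_Lam smooth_part_affine; clear t01.
move: (convex_part tau (Lam a)) (convex_part tau (Lam b)) (convex_part tau _).
move: (smooth_part mu f a) (smooth_part mu f b) (curvature mu _).
by move=> sa sb k ca cb c; lra.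
Qed.

Lemma objectiveH_convex : (forall l, 1 <= mu 0 l / beta R l) ->
  convex_on (hankel R N) (objectiveH tau mu f).
Proof.
move=> h A B t /Lam_invK <- /Lam_invK <- t01.
apply: le_trans (objectiveH_convexity_defect _ _ t01) _.
rewrite lerBlDr lerDl; case/andP: t01 => t0 t1.
rewrite !mulr_ge0 ?subr_ge0 // sumr_ge0 // => l _.
rewrite mulr_ge0 ?sqr_ge0 // subr_ge0.
by have := h l; rewrite ler_pdivlMr ?beta_gt0 // mul1r.
Qed.

Lemma objectiveH_strictly_convex : (forall l, 1 < mu 0 l / beta R l) ->
  strictly_convex_on (hankel R N) (objectiveH tau mu f).
Proof.
move=> h A B t /Lam_invK <- /Lam_invK <-.
move: (Lam_inv A) (Lam_inv B) => {A B} a b ab /andP[t0 t1].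
apply: le_lt_trans (objectiveH_convexity_defect _ _ _) _; first by rewrite !ltW.
rewrite ltrBlDr ltrDl !mulr_gt0 ?subr_gt0 //.
have gap l : 0 < mu 0 l - beta R l.
  by rewrite subr_gt0; have := h l; rewrite ltr_pdivlMr ?beta_gt0 // mul1r.
have term_ge0 l : true -> 0 <= (mu 0 l - beta R l) * Normc.normc ((a - b) 0 l) ^+ 2.
  by move=> _; rewrite mulr_ge0 ?sqr_ge0 // ltW.
rewrite lt0r sumr_ge0 // andbT psumr_eq0 //; apply/negP => /allP z.
apply: ab; congr Lam; apply/rowP => l.
have := z l; rewrite mem_index_enum mulf_eq0 gt_eqF //= expf_eq0 /=.
by move=> /(_ isT)/eqP/Normc.eq0_normc/eqP; rewrite !mxE subr_eq0 => /eqP.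
Qed.

Lemma qUmap_Lam a : q%:C *: Umap q mu (Fmat q mu f) (Lam a) =
  (q - 1)%:C *: Lam a - 2^-1%:C *: Lam (smooth_grad mu f a).
Proof.
have qN : q != 0 by rewrite gt_eqF // (lt_trans ltr01).
have bN (l : 'I_(2 * N - 1)) : beta R l != 0 by rewrite gt_eqF // beta_gt0.
have e : \row_l ((mu 0 l / (q * beta R l ^+ 2))%:C * Lam_adj (Lam a) 0 l) =
    \row_l ((mu 0 l / (q * beta R l))%:C * a 0 l).
  apply/rowP => l; rewrite [LHS]mxE [RHS]mxE Lam_adj_Lam mulrA -rmorphM /=.
  by congr (_%:C * _); field; rewrite qN bN.
rewrite /Umap e /Fmat -LamD -LamB -!LamZ -LamB; congr Lam; apply/rowP => l.
rewrite !mxE -rmorphV ?unitfE ?mulf_neq0 // -mulrA -rmorphM /=.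
have := bN l; move: (beta R l) (mu 0 l) => be m beN.
apply/eqP; rewrite eq_complex.
case: (a 0 l) (f 0 l) => [x y] [g h] /=.
by apply/andP; split; apply/eqP; field; rewrite ?qN ?beN.
Qed.

(** The second component of the fixed point equation determines P_H(W), and with
    this value the argument of the singular value map becomes (q - 1)A + W. *)
Lemma fixed_pointP a W :
  Bweight tau q mu f (W, Lam a) = (W, Lam a) <->
  half_subgradient tau (Lam a) W /\
  Lam (Lam_inv W) = - (2^-1%:C *: Lam (smooth_grad mu f a)).
Proof.
have q1 : q - 1 != 0 by rewrite subr_eq0 gt_eqF.
have qC : (q - 1)%:C * (q - 1)^-1%:C = 1 :> R[i] by rewrite -rmorphM /= mulfV.
rewrite /Bweight orth_proj_hankel orth_proj_hankel_compl qUmap_Lam.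
rewrite (half_subgradientP tau_gt0 q_gt1).
set g := 2^-1%:C *: _; set A := Lam a; set P := Lam (Lam_inv W).
have arg : P = - g -> (q - 1)%:C *: A - g + (W - P) = (q - 1)%:C *: A + W.
  by move=> ->; rewrite opprK [W + g]addrC addrA subrK.
split=> [[eW eA]|[eW eP]]; last first.
  by rewrite (arg eP) -eW -/P eP opprK subrK scalerA mulrC qC scale1r.
have eP : P = - g.
  have := congr1 (GRing.scale (q - 1)%:C) eA; rewrite eW scalerA qC scale1r.
  rewrite -/P -addrA => /eqP; rewrite -subr_eq0 addrAC subrr add0r => /eqP.
  by move=> /addr0_eq; rewrite opprK => ->; rewrite opprK.
by split=> //; rewrite -{1}eW arg.
Qed.

(** G and 2 W correspond: G = 2 P_H(W) in one direction, and in the other 2 W is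
    an extension of G from the Hankel matrices to the whole space. *)
Lemma stationaryP a :
  stationary (hankel R N) (@convex_part R N tau) (objectiveH tau mu f) (Lam a) <->
  exists W, half_subgradient tau (Lam a) W /\
    Lam (Lam_inv W) = - (2^-1%:C *: Lam (smooth_grad mu f a)).
Proof.
set g := Lam (smooth_grad mu f a).
have grad_g : is_gradient (hankel R N)
    (fun B => objectiveH tau mu f B - convex_part tau B) (Lam a) g.
  exact: smooth_is_gradient.
have [hg _] := grad_g; have ha := Lam_hankel a.
split=> [[G [H [[hG subG] gradH GH0]]]|[W [subW eP]]]; last first.
  exists (- g), g; split=> //; last by rewrite addrC subrr.
  split=> [|B hB]; first by rewrite -sub0r; exact: hankelB (@hankel0 R N) hg.
  have := subW B; rewrite -(rdot_Lam_inv W (hankelB hB ha)) eP.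
  by rewrite !rdotNl rdotZl mulrN mulrA mulfV ?mul1r // pnatr_eq0.
have eG : G = - g.
  by rewrite (is_gradient_unique (@hankel_subspace R N) ha grad_g gradH)
    -(addr0_eq GH0) opprK.
have subG0 : subgradient (@convex_part R N tau) (Lam a) (hankel R N) G.
  move=> X hX; have hB : hankel R N (Lam a + X).
    exact: hankelD.
  by have := subG _ hB; rewrite [_ + X - _]addrAC subrr add0r.
have [G' G'G subG'] := hahn_banach_subgradient (convex_part_convex tau_gt0)
  (@hankel_subspace R N) (@hankel0 R N) (@hankel_projectable R N) subG0.
have half : 2 * 2^-1 = 1 :> R by rewrite mulfV ?pnatr_eq0.
exists (2^-1%:C *: G'); split=> [B|].
  rewrite rdotZl mulrA half mul1r.
  by have := subG' (B - Lam a) I; rewrite [Lam a + _]addrC subrK.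
apply: hankel_proj_unique => [|Y hY].
  by rewrite -sub0r -LamZ; exact: hankelB (@hankel0 R N) (@Lam_hankel R N _).
by rewrite rdotZl G'G // eG !rdotNl rdotZl mulrN.
Qed.

End Objective.

Theorem corollary6p1 (R : realType) (N : nat) (hN : (1 <= N)%N)
    (f : 'rV[R[i]]_(2 * N - 1)) (tau q : R) (mu : 'rV[R]_(2 * N - 1))
    (htau : 0 < tau) (hq : 1 < q) (hmu : forall l, 0 < mu 0 l)
    (hqmu : forall l, mu 0 l / beta R l <= q)
    (a0 : 'rV[R[i]]_(2 * N - 1)) :
  [/\ (exists W0 : 'M[R[i]]_N,
         Bweight tau q mu f (W0, Lam a0) = (W0, Lam a0)) <->
      stationary (hankel R N) (@convex_part R N tau)
        (objectiveH tau mu f) (Lam a0),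
      (forall l, 1 <= mu 0 l / beta R l) ->
        convex_on (hankel R N) (objectiveH tau mu f) &
      (forall l, 1 < mu 0 l / beta R l) ->
        strictly_convex_on (hankel R N) (objectiveH tau mu f)].
Proof.
split; [|exact: objectiveH_convex|exact: objectiveH_strictly_convex].
rewrite stationaryP //.
by split=> -[W hW]; exists W; [rewrite -(fixed_pointP mu f htau hq)|rewrite fixed_pointP].
Qed.
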